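(* Let $W=\mathbb C^k$ and let $\mathcal B\in W^*\otimes W^*$ be a full rank bilinear form. Write $\mathcal B=Q+\Lambda$ with $Q\in S^2W^*$ symmetric and $\Lambda\in\Lambda^2W^*$ skew-symmetric, let $E=\ker\Lambda$, $F=\ker Q$, let $L\subset W$ be a complement of $E\oplus F$, and put $e=\dim E$, $\ell=\dim L$, $f=\dim F$. Let $\mathfrak h_{\mathcal B}$ be the annihilator of $\mathcal B$. Then $$\dim\mathfrak h_{\mathcal B}<\binom k2$$ except in the following cases: (i) $(e,\ell,f)=(0,0,k)$ (so $k$ is even): in this case $\mathcal B=\Lambda$ is skew-symmetric and $\mathfrak h_{\mathcal B}=\mathfrak{sp}(\Lambda)$, with $\dim\mathfrak h_{\mathcal B}=\binom{k+1}2$; (ii) $(e,\ell,f)=(k,0,0)$: in this case $\mathcal B=Q$ is symmetric and $\mathfrak h_{\mathcal B}=\mathfrak{so}(Q)$, with $\dim\mathfrak h_{\mathcal B}=\binom k2$; (iii) $(e,\ell,f)=(0,1,k-1)$ (so $k$ is even): in this case $\dim\mathfrak h_{\mathcal B}=\binom k2$; (iv) $(e,\ell,f)=(1,0,k-1)$ (so $k$ is odd): in this case $\mathfrak h_{\mathcal B}=\mathfrak{sp}(\Lambda|_F)$, with $\dim\mathfrak h_{\mathcal B}=\binom k2$.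
   Context: Everything is over $\mathbb C$. Identifying bilinear forms with $k\times k$ matrices, $GL_k$ acts by $g\cdot\mathcal B=g\mathcal B g^{\mathbf t}$ (where $\mathbf t$ denotes transpose). $H_{\mathcal B}\subset GL_k$ is the stabilizer of $\mathcal B$ and $\mathfrak h_{\mathcal B}$ is its Lie algebra, i.e. $\mathfrak h_{\mathcal B}=\{X\in\mathfrak{gl}_k: X\mathcal B+\mathcal BX^{\mathbf t}=0\}$. Since $\mathcal B$ has full rank, $E\cap F=0$, so $W=E\oplus L\oplus F$ and $e+\ell+f=k$; note that $\ell+f=\operatorname{rk}(\Lambda)$ is even. For a subspace $U\subset W$, $\Lambda|_U$ denotes the restriction of $\Lambda$ to $U\times U$. $\mathfrak{sp}(\Lambda)$ and $\mathfrak{so}(Q)$ denote the Lie algebras annihilating the nondegenerate skew form $\Lambda$, respectively the nondegenerate symmetric form $Q$. In (iv), $\mathfrak{sp}(\Lambda|_F)$ is regarded inside $\mathfrak{gl}(W)$ via the decomposition $W=E\oplus F$, acting by zero on $E$.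
   Formalization: The strict inequality is stated with the additional exception (e,ℓ,f)=(0,2,0) (so k=2), where it fails: if Q and Λ are both nondegenerate on C^2, then the annihilator is so(Q), of dimension 1 = binom(2,2). *)

(* Defs.v *)
From HB Require Import structures.
From mathcomp Require Import all_boot all_order all_algebra.
From mathcomp Require Import reals.
From mathcomp Require Export complex.

Set Implicit Arguments.
Unset Strict Implicit.
Unset Printing Implicit Defensive.

Import GRing.Theory.
Local Open Scope ring_scope.

(* Vectors of W = F^k are row vectors and a subspace of W is the row space of a
   matrix. The matrix B stands for the bilinear form (u, v) |-> u *m B *m v^T
   and X : 'M_k for the endomorphism u |-> u *m X. With these conventions
     B(u X, v) + B(u, v X) = u *m (X *m B + B *m X^T) *m v^T,
   which is the derivative of g |-> g *m B *m g^T at the identity. *)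

Section Annihilator.
Variables (F : fieldType) (k : nat).
Implicit Types (B X : 'M[F]_k).

Definition lie_act B X : 'M[F]_k := X *m B + B *m X^T.

Fact lie_act_is_linear B : linear (lie_act B).
Proof.
move=> a X Y; rewrite /lie_act linearP mulmxDl mulmxDr -scalemxAl -scalemxAr.
by rewrite scalerDr addrACA.
Qed.

HB.instance Definition _ B :=
  GRing.isLinear.Build F 'M[F]_k 'M[F]_k _ (lie_act B) (lie_act_is_linear B).

Definition annihilator B : {vspace 'M[F]_k} := lker (linfun (lie_act B)).

Lemma mem_annihilator B X :
  (X \in annihilator B) = (X *m B + B *m X^T == 0).
Proof. by rewrite memv_ker lfunE. Qed.

End Annihilator.

(* Only used for nondegenerate skew-symmetric Lam, resp. nondegenerate
   symmetric Q. *)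
Definition sp (F : fieldType) (k : nat) (Lam : 'M[F]_k) := annihilator Lam.
Definition so (F : fieldType) (k : nat) (Q : 'M[F]_k) := annihilator Q.

(* The restriction of a form to a subspace U, as the Gram matrix in the basis
   of U given by the rows of row_base U. *)
Definition restr_form (F : fieldType) (k : nat) (Lam U : 'M[F]_k) :
    'M[F]_(\rank U) :=
  row_base U *m Lam *m (row_base U)^T.

(* X is zero on E, and maps U to itself by the endomorphism with matrix Y in
   the basis row_base U. When W is the direct sum of E and U, each Y has
   exactly one such X. *)
Definition extends_by_zero (F : fieldType) (k : nat) (E U : 'M[F]_k)
    (Y : 'M[F]_(\rank U)) (X : 'M[F]_k) : Prop :=
  E *m X = 0 /\ row_base U *m X = Y *m row_base U.

Definition is_complement (F : fieldType) (k : nat) (L U : 'M[F]_k) : Prop :=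
  (L :&: U == (0 : 'M[F]_k))%MS /\ (L + U == (1%:M : 'M[F]_k))%MS.

(* Main.v *)
Require Import Defs.
From HB Require Import structures.
From mathcomp Require Import all_boot all_order all_algebra.
From mathcomp Require Import reals.
From mathcomp Require Import zify.

(* The annihilator h of B is the intersection of the annihilators of Q and Lam,
   because X B + B X^T splits into a symmetric and a skew part.  On h the map
   X |-> X Q takes skew values with row space in that of Q, and on its kernel
   the map X |-> X Lam is an isomorphism onto the symmetric matrices with row
   space in F Lam, a space of dimension f because E and F meet trivially.  Hence
     'C(f + 1, 2) <= dim h <= 'C(f + 1, 2) + 'C(k - f, 2),
   which gives everything when f > 0: the upper bound is less than 'C(k, 2) as
   soon as k - f >= 2, and the two bounds agree when k - f <= 1.
   When f = 0, h lies in so(Q), of dimension 'C(k, 2); equality would force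
   Q^-1 Lam to act trivially on skew matrices, which for k >= 3 gives Lam = 0. *)

Set Implicit Arguments.
Unset Strict Implicit.
Unset Printing Implicit Defensive.

Local Open Scope ring_scope.
Import GRing.Theory Num.Theory.

(** * Dimension comparison and counting of index pairs *)

Lemma leq_dim_inj (K : fieldType) (aT rT : vectType K) (f : 'Hom(aT, rT))
    (U : {vspace aT}) (V : {vspace rT}) :
  (forall x, x \in U -> f x \in V) ->
  (forall x, x \in U -> f x = 0 -> x = 0) -> (\dim U <= \dim V)%N.
Proof.
move=> fUV f_inj; rewrite -(limg_dim_eq (f := f)); last first.
  apply/eqP; rewrite -subv0; apply/subvP => x /memv_capP [xU].
  by rewrite memv_ker memv0 => /eqP /(f_inj _ xU) ->.
by apply/dimvS/subvP => _ /memv_imgP [x xU ->]; apply: fUV.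
Qed.

Lemma bin2S_add_bin2 (n : nat) : ('C(n.+1, 2) + 'C(n, 2) = n * n)%N.
Proof. by elim: n => // n; rewrite !binS !bin1 !bin0; lia. Qed.

(** For a fixed second coordinate [j] there are [j] choices of the first, and [j] runs over all
    values below [n]. *)
Lemma card_ltn_pairs (n : nat) :
  #|[pred p : 'I_n * 'I_n | (p.1 < p.2)%N]| = 'C(n, 2).
Proof.
rewrite -sum1_card /= -bin2_sum big_mkord.
rewrite -(pair_big_dep xpredT (fun i j : 'I_n => (i < j)%N) (fun _ _ => 1%N)) /=.
rewrite (exchange_big_dep xpredT) //=; apply: eq_bigr => j _.
rewrite sum1_card -[RHS]card_ord.
have le_jn : (j <= n)%N by apply: ltnW.
rewrite -(@card_image _ _ (widen_ord le_jn) _ 'I_j); last first.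
  by move=> x y /(congr1 val) /= /val_inj.
apply: eq_card => i; apply/idP/imageP => [lt_ij|[x _ ->]].
  by exists (Ordinal (lt_ij : (i < j)%N)) => //; apply: val_inj.
exact: (ltn_ord x).
Qed.

(** Swapping coordinates matches the strict pairs with the complement of the weak ones, so the two
    counts add up to [n * n]. *)
Lemma card_leq_pairs (n : nat) :
  #|[pred p : 'I_n * 'I_n | (p.1 <= p.2)%N]| = 'C(n.+1, 2).
Proof.
apply/eqP; rewrite -(eqn_add2r 'C(n, 2)) -{1}card_ltn_pairs.
have /= -> : #|[pred p : 'I_n * 'I_n | (p.1 < p.2)%N]| =
    #|[predC [pred p : 'I_n * 'I_n | (p.1 <= p.2)%N]]|.
  rewrite -(card_image (f := fun p : 'I_n * 'I_n => (p.2, p.1))); last first.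
    by move=> [x y] [z t] /= [-> ->].
  apply: eq_card => -[x y]; rewrite !inE /= -ltnNge.
  apply/imageP/idP => [[[z t] lt_zt [-> ->]]//|lt_yx].
  by exists (y, x).
by rewrite cardC card_prod card_ord bin2S_add_bin2.
Qed.

(** * Symmetric and skew-symmetric matrices with prescribed row space *)

Section TwistedSymmetric.
Variable K : fieldType.

(* Used for a = 1 (symmetric) and a = -1 (skew-symmetric). *)
Definition twisted_sym (a : K) (m k : nat) (P : 'M[K]_(m, k)) :
    {vspace 'M[K]_k} :=
  (lker (linfun trmx - a *: \1%VF) :&: lker (linfun (mulmxr (cokermx P))))%VS.

Lemma mem_twisted_sym a m k (P : 'M[K]_(m, k)) S :
  (S \in twisted_sym a P) = (S^T == a *: S) && (S <= P)%MS.
Proof.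
rewrite memv_cap !memv_ker submxE add_lfunE opp_lfunE scale_lfunE id_lfunE.
by rewrite !lfunE /= subr_eq0.
Qed.

(** The row space condition gives [S = S *m pinvmx P *m P]; as [S^T] is a multiple of [S],
    transposing yields the matching factor on the left. *)
Lemma twisted_sym_factor a m k (P : 'M[K]_(m, k)) S :
  S^T = a *: S -> (S <= P)%MS -> S = P^T *m ((pinvmx P)^T *m S *m pinvmx P) *m P.
Proof.
move=> symS /mulmxKpV; move: (pinvmx P) => G SGP.
rewrite -!mulmxA (mulmxA S) SGP; apply: trmx_inj.
by rewrite 2!trmx_mul !trmxK symS -!scalemxAl SGP.
Qed.

Lemma twisted_sym_congr a m k (S : 'M[K]_m) (G : 'M[K]_(m, k)) :
  S^T = a *: S -> (G^T *m S *m G)^T = a *: (G^T *m S *m G).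
Proof.
by move=> symS; rewrite !trmx_mul trmxK symS -scalemxAl -scalemxAr mulmxA.
Qed.

(** Congruences by [pinvmx P] and by [P] are injective in opposite directions. *)
Lemma dim_twisted_sym_row_free a m k (P : 'M[K]_(m, k)) :
  row_free P -> \dim (twisted_sym a P) = \dim (twisted_sym a (1%:M : 'M_m)).
Proof.
move=> freeP; apply/eqP; rewrite eqn_leq; apply/andP; split.
  apply: (leq_dim_inj
    (f := linfun (mulmx (pinvmx P)^T \o mulmxr (pinvmx P)))) => S;
    rewrite mem_twisted_sym => /andP [/eqP symS SP]; rewrite lfunE /= mulmxA.
  - by rewrite mem_twisted_sym (twisted_sym_congr _ symS) eqxx submx1.
  - by move=> S0; rewrite (twisted_sym_factor symS SP) S0 mulmx0 mul0mx.
apply: (leq_dim_inj (f := linfun (mulmx P^T \o mulmxr P))) => S;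
  rewrite mem_twisted_sym => /andP [/eqP symS _]; rewrite lfunE /= mulmxA.
- by rewrite mem_twisted_sym (twisted_sym_congr _ symS) eqxx submxMl.
- move/eqP; rewrite mulmx_free_eq0 // => /eqP PS0.
  move/eqP: PS0; rewrite -(inj_eq trmx_inj) trmx_mul trmxK trmx0.
  by rewrite mulmx_free_eq0 // => /eqP S0; apply: trmx_inj; rewrite S0 trmx0.
Qed.

(** Reading off the entries at [A] is injective on these matrices. *)
Lemma dim_twisted_sym_leq a r (A : {pred 'I_r * 'I_r}) :
  (forall S : 'M[K]_r, S^T = a *: S -> (forall p, p \in A -> S p.1 p.2 = 0) -> S = 0) ->
  (\dim (twisted_sym a (1%:M : 'M_r)) <= #|A|)%N.
Proof.
move=> A_det.
pose entries (S : 'M[K]_r) : 'rV[K]_#|A| :=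
  \row_j S (enum_val j).1 (enum_val j).2.
have entries_lin : linear entries.
  by move=> b S T; apply/rowP => j; rewrite !mxE.
pose entriesL := GRing.isLinear.Build _ _ _ _ entries entries_lin.
pose f : {linear 'M[K]_r -> 'rV[K]_#|A|} := HB.pack entries entriesL.
have <- : \dim {: 'rV[K]_#|A|} = #|A| by rewrite dimvf dim_matrix mul1r.
apply: (leq_dim_inj (f := linfun f)) => S; rewrite ?memvf // lfunE /=.
rewrite mem_twisted_sym => /andP [/eqP symS _] S0; apply: A_det => // p pA.
have /rowP/(_ (enum_rank_in pA p)) := S0.
by rewrite !mxE enum_rankK_in.
Qed.

Hypothesis two_neq0 : 2%:R != 0 :> K.

(* Both upper bounds are attained because they add up to r ^ 2. *)
Lemma dim_twisted_sym1 r :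
  \dim (twisted_sym 1 (1%:M : 'M_r)) = 'C(r.+1, 2) /\
  \dim (twisted_sym (-1) (1%:M : 'M_r)) = 'C(r, 2).
Proof.
set U := twisted_sym 1 _; set V := twisted_sym (-1) _.
have leU : (\dim U <= 'C(r.+1, 2))%N.
  rewrite -card_leq_pairs; apply: dim_twisted_sym_leq => S symS S0.
  apply/matrixP => i j; rewrite mxE; have [le_ij|/ltnW le_ji] := leqP i j.
    exact: (S0 (i, j)).
  have /matrixP/(_ i j) := symS; rewrite !mxE mul1r => <-.
  exact: (S0 (j, i)).
have leV : (\dim V <= 'C(r, 2))%N.
  rewrite -card_ltn_pairs; apply: dim_twisted_sym_leq => S symS S0.
  apply/matrixP => i j; rewrite mxE; have [lt_ij|lt_ji|/val_inj <-] := ltngtP i j.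
  - exact: (S0 (i, j)).
  - have /matrixP/(_ j i) := symS; rewrite !mxE => ->.
    by rewrite (S0 (j, i)) ?mulr0.
  - have /matrixP/(_ i i) := symS; rewrite !mxE mulN1r => /eqP.
    by rewrite eq_sym -subr_eq0 -opprD oppr_eq0 -mulr2n -mulr_natl mulf_eq0
      (negPf two_neq0) => /eqP.
have UV : \dim (U + V) = (\dim U + \dim V)%N.
  apply: dimv_disjoint_sum; apply/eqP; rewrite -subv0; apply/subvP => S.
  move=> /memv_capP []; rewrite !mem_twisted_sym => /andP [/eqP -> _].
  rewrite scale1r scaleN1r -subr_eq0 opprK -mulr2n -scaler_nat scaler_eq0.
  by rewrite (negPf two_neq0) /= submx1 andbT memv0.
have full : (U + V)%VS = fullv.
  apply/eqP; rewrite eqEsubv subvf /=; apply/subvP => S _.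
  apply/memv_addP; exists (2%:R^-1 *: (S + S^T)); last first.
    exists (2%:R^-1 *: (S - S^T)); last first.
      rewrite -scalerDr addrACA subrr addr0 -mulr2n -scaler_nat scalerA mulVf //.
      by rewrite scale1r.
    by rewrite mem_twisted_sym linearZ linearB /= trmxK scaleN1r -scalerN opprB eqxx submx1.
  by rewrite mem_twisted_sym linearZ linearD /= trmxK scale1r addrC eqxx submx1.
move: UV; rewrite full dimvf dim_matrix.
have := bin2S_add_bin2 r.
by rewrite /GRing.mul /=; lia.
Qed.

Lemma dim_sym m k (P : 'M[K]_(m, k)) :
  \dim (twisted_sym 1 P) = 'C((\rank P).+1, 2).
Proof.
have [<- _] := dim_twisted_sym1 (\rank P).
rewrite -(dim_twisted_sym_row_free _ (P := row_base P)) ?row_base_free //.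
congr (\dim _); apply/vspaceP => S; rewrite !mem_twisted_sym.
by rewrite eq_row_base.
Qed.

Lemma dim_skew m k (P : 'M[K]_(m, k)) :
  \dim (twisted_sym (-1) P) = 'C(\rank P, 2).
Proof.
have [_ <-] := dim_twisted_sym1 (\rank P).
rewrite -(dim_twisted_sym_row_free _ (P := row_base P)) ?row_base_free //.
congr (\dim _); apply/vspaceP => S; rewrite !mem_twisted_sym.
by rewrite eq_row_base.
Qed.

(** Transposing gives [\det S = (-1) ^+ n * \det S]. *)
Lemma skew_unitmx_even n (S : 'M[K]_n) :
  S^T = - S -> S \in unitmx -> ~~ odd n.
Proof.
move=> skewS; rewrite unitmxE unitfE => detS; apply/negP => odd_n.
have := det_tr S; rewrite skewS -scaleN1r detZ -signr_odd odd_n mulN1r => /eqP.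
by rewrite eq_sym -subr_eq0 opprK -mulr2n -mulr_natl mulf_eq0 (negPf two_neq0)
  (negPf detS).
Qed.

(** In a basis of its row space, [S] becomes a skew matrix [D] of size [\rank S], which is
    invertible because [S] factors through it. *)
Lemma skew_rank_even n (S : 'M[K]_n) : S^T = - S -> ~~ odd (\rank S).
Proof.
move=> skewS; have skewS' : S^T = -1 *: S by rewrite scaleN1r.
pose P := row_base S; pose D := (pinvmx P)^T *m S *m pinvmx P.
have SD : S = P^T *m D *m P.
  by apply: (twisted_sym_factor (P := P) skewS'); rewrite eq_row_base.
apply: (skew_unitmx_even (S := D)); first by rewrite (twisted_sym_congr _ skewS') scaleN1r.
rewrite -row_full_unit /row_full eqn_leq rank_leq_row /=.
rewrite {1}SD; apply: leq_trans (mxrankM_maxl _ _) _; exact: mxrankM_maxr.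
Qed.

End TwistedSymmetric.

Lemma bin2D (m n : nat) : 'C(m + n, 2) = ('C(m, 2) + 'C(n, 2) + m * n)%N.
Proof.
elim: n => [|n IHn]; first by rewrite bin0n muln0 !addn0.
by rewrite addnS !(binS _ 1) !bin1 IHn; lia.
Qed.

Lemma exists_third (n : nat) (i j : 'I_n) :
  (2 < n)%N -> exists2 l : 'I_n, l != i & l != j.
Proof.
move=> n_gt2; have : ~~ ([set: 'I_n] \subset [set i; j]).
  apply/negP => /subset_leq_card; rewrite cardsT card_ord cards2.
  by case: (i != j) => /(leq_trans n_gt2).
by case/subsetPn => l _; rewrite !inE negb_or => /andP [] li lj; exists l.
Qed.

(** * Annihilators of symmetric and skew-symmetric forms *)

Section AnnihilatorDimension.
Variables (K : fieldType) (k : nat).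
Hypothesis two_neq0 : 2%:R != 0 :> K.
Implicit Types Q Lam X S : 'M[K]_k.

(** The hypothesis says that [X] preserves the row space of [G] and acts there through [Y]; the
    action then commutes with restricting forms to that space. *)
Lemma lie_act_congr m (G : 'M[K]_(m, k)) (Y : 'M[K]_m) Lam X :
  G *m X = Y *m G ->
  lie_act (G *m Lam *m G^T) Y = G *m lie_act Lam X *m G^T.
Proof.
move=> GX; rewrite /lie_act mulmxDr mulmxDl !mulmxA GX.
by rewrite -(mulmxA _ G^T) -(mulmxA _ X^T) -!trmx_mul GX.
Qed.

Lemma annihilator_cap Q Lam : Q^T = Q -> Lam^T = - Lam ->
  annihilator (Q + Lam) = (annihilator Q :&: annihilator Lam)%VS.
Proof.
move=> symQ skewLam; apply/vspaceP => X; rewrite memv_cap !mem_annihilator.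
rewrite mulmxDr mulmxDl addrACA.
set s := X *m Q + _; set t := X *m Lam + _.
have symS : s^T = s by rewrite /s linearD /= !trmx_mul trmxK symQ addrC.
have skewT : t^T = - t.
  by rewrite /t linearD /= !trmx_mul trmxK skewLam mulmxN mulNmx -opprD addrC.
apply/eqP/andP => [st0|[/eqP -> /eqP ->]]; last by rewrite addr0.
have st0' : s - t = 0 by have := congr1 trmx st0; rewrite linearD /= symS skewT trmx0.
have s0 : s = 0.
  have /eqP : (s + t) + (s - t) = 0 by rewrite st0 st0' addr0.
  rewrite addrACA subrr addr0 -mulr2n -scaler_nat scaler_eq0.
  by rewrite (negPf two_neq0) => /eqP.
by rewrite s0 -st0 s0 add0r.
Qed.

(** The map [X |-> X *m Q] is a bijection onto the skew matrices. *)
Lemma dim_annihilator_sym Q :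
  Q^T = Q -> Q \in unitmx -> \dim (annihilator Q) = 'C(k, 2).
Proof.
move=> symQ unitQ; rewrite -[in RHS](mxrank1 K k) -(dim_skew two_neq0).
apply/eqP; rewrite eqn_leq; apply/andP; split.
  apply: (leq_dim_inj (f := linfun (mulmxr Q))) => X; rewrite lfunE /=.
    rewrite mem_annihilator mem_twisted_sym submx1 andbT trmx_mul symQ scaleN1r.
    by rewrite addrC addr_eq0.
  by move=> _ /(canRL (mulmxK unitQ)); rewrite mul0mx.
apply: (leq_dim_inj (f := linfun (mulmxr (invmx Q)))) => S; rewrite lfunE /=.
  rewrite mem_annihilator mem_twisted_sym submx1 andbT scaleN1r => /eqP skewS.
  by rewrite mulmxKV // trmx_mul trmx_inv symQ skewS mulmxA mulmxV // mul1mx subrr.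
by move=> _ /(canRL (mulmxKV unitQ)); rewrite mul0mx.
Qed.

Lemma annihilator_sym_sub Q Lam : (2 < k)%N -> Q^T = Q -> Q \in unitmx ->
  Lam^T = - Lam -> (annihilator Q <= annihilator Lam)%VS -> Lam = 0.
Proof.
move=> k_gt2 symQ unitQ skewLam sub.
(* N acts by zero on every skew S; the choices S = e_ij - e_ji give N = 0. *)
pose N := invmx Q *m Lam.
have N_inv S : S^T = - S -> S *m N + N^T *m S = 0.
  move=> skewS; have : S *m invmx Q \in annihilator Lam.
    apply: (subvP sub); rewrite mem_annihilator mulmxKV // trmx_mul trmx_inv symQ.
    by rewrite skewS mulmxA mulmxV // mul1mx subrr.
  rewrite mem_annihilator trmx_mul trmx_inv symQ skewS => /eqP h.
  rewrite -[RHS]h /N trmx_mul trmx_inv symQ skewLam !mulmxA mulmxN.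
  by rewrite !mulNmx.
rewrite -(mulKVmx unitQ Lam) -/N; suff -> : N = 0 by rewrite mulmx0.
move: N N_inv => {}N N_inv.
(* This is the entry [(a, b)] of [S *m N + N^T *m S] for [S = e_ij - e_ji]. *)
have entry i j a b : (a == i)%:R * N j b - (a == j)%:R * N i b
    + (N i a * (b == j)%:R - N j a * (b == i)%:R) = 0.
  have /N_inv /matrixP/(_ a b) :
      (delta_mx i j - delta_mx j i)^T = - (delta_mx i j - delta_mx j i) :> 'M[K]_k.
    by rewrite linearB /= !trmx_delta opprB.
  rewrite mulmxBl mulmxBr !mxE => h; rewrite -[RHS]h; congr (_ - _ + (_ - _)).
  - rewrite (bigD1 j) //= mxE eqxx andbT big1 ?addr0 // => c /negPf cj.
    by rewrite mxE cj andbF mul0r.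
  - rewrite (bigD1 i) //= mxE eqxx andbT big1 ?addr0 // => c /negPf cj.
    by rewrite mxE cj andbF mul0r.
  - rewrite (bigD1 i) //= !mxE eqxx big1 ?addr0 // => c /negPf cj.
    by rewrite !mxE cj mulr0.
  - rewrite (bigD1 j) //= !mxE eqxx big1 ?addr0 // => c /negPf cj.
    by rewrite !mxE cj mulr0.
have diag i j : i != j -> N i i = - N j j.
  move=> ij; have := entry i j i j.
  rewrite !eqxx (negPf ij) eq_sym (negPf ij) !mulr0 !mul0r mul1r mulr1 !subr0.
  by move/eqP; rewrite addrC addr_eq0 => /eqP.
apply/matrixP => j b; rewrite mxE; have [<-|jb] := eqVneq j b.
  (* Three distinct indices give [N j j = - N i i = N c c = - N j j]. *)
  have [i ij _] := exists_third j j k_gt2.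
  have [c cj ci] := exists_third j i k_gt2.
  have : N j j = - N j j.
    by rewrite {1}(diag j i) 1?eq_sym // (diag i c) 1?eq_sym // opprK (diag c j).
  move/eqP; rewrite -subr_eq0 opprK -mulr2n -mulr_natl mulf_eq0.
  by rewrite (negPf two_neq0) => /eqP.
(* With [i] distinct from [j] and [b], only [N j b] survives in the entry [(i, b)]. *)
have [i ij ib] := exists_third j b k_gt2.
have := entry i j i b; rewrite eqxx (negPf ij) ![b == _]eq_sym (negPf jb) (negPf ib).
by rewrite mul1r mul0r !mulr0 !subr0 addr0.
Qed.

(** * Bounds on the annihilator of a nondegenerate form *)

Section NondegenerateSum.
Variables Q Lam : 'M[K]_k.
Hypotheses (symQ : Q^T = Q) (skewLam : Lam^T = - Lam).
Hypothesis fullB : \rank (Q + Lam)%R = k.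

Lemma mul_sym_skew_eq0 m (A : 'M[K]_(m, k)) :
  A *m Q = 0 -> A *m Lam = 0 -> A = 0.
Proof.
move=> AQ AL; apply/eqP.
rewrite -(@mulmx_free_eq0 _ _ _ _ A (Q + Lam)) ?mulmxDr ?AQ ?AL ?addr0 //.
by rewrite /row_free fullB.
Qed.

Lemma cap_kermx_sym_skew : (kermx Q :&: kermx Lam = 0)%MS.
Proof.
apply: mul_sym_skew_eq0; apply/sub_kermxP; first exact: capmxSl.
exact: capmxSr.
Qed.

Lemma dim_annihilator_ker :
  \dim (annihilator (Q + Lam) :&: lker (linfun (mulmxr Q))) =
    'C((\rank (kermx Q)).+1, 2).
Proof.
pose P := kermx Q *m Lam.
(* [Lam] is injective on [F] because its kernel [E] meets [F] trivially. *)
have <- : \rank P = \rank (kermx Q).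
  by apply/mxrank_injP; rewrite cap_kermx_sym_skew.
rewrite -(dim_sym two_neq0).
apply/eqP; rewrite eqn_leq; apply/andP; split.
  apply: (leq_dim_inj (f := linfun (mulmxr Lam))) => X; rewrite [linfun _ X]lfunE /=;
    rewrite annihilator_cap // 2!memv_cap memv_ker lfunE /= => /andP [].
    rewrite mem_annihilator => /andP [_]; rewrite mem_annihilator => XL /eqP XQ.
    rewrite mem_twisted_sym scale1r trmx_mul skewLam mulNmx.
    rewrite eq_sym -subr_eq0 opprK XL /=.
    have /submxP [Y ->] : (X <= kermx Q)%MS by apply/sub_kermxP.
    by rewrite -mulmxA submxMl.
  by move=> _ /eqP; apply: mul_sym_skew_eq0.
(* The inverse of [X |-> X *m Lam]: write the rows of [S] as combinations of the rows of [P], then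
   take the same combinations of the rows of [kermx Q]. *)
pose g : {linear 'M[K]_k -> 'M[K]_k} := mulmxr (kermx Q) \o mulmxr (pinvmx P).
have gL S : (S <= P)%MS -> g S *m Lam = S.
  by move=> SP; rewrite /g /= -mulmxA mulmxKpV.
apply: (leq_dim_inj (f := linfun g)) => S;
  rewrite mem_twisted_sym scale1r => /andP [/eqP symS SP]; rewrite lfunE; last first.
  by move=> gS0; rewrite -(gL _ SP) gS0 mul0mx.
have gQ : g S *m Q = 0 by rewrite /g /= -mulmxA mulmx_ker mulmx0.
rewrite annihilator_cap // !memv_cap memv_ker !lfunE /= !mem_annihilator.
rewrite gQ eqxx andbT add0r -{1}symQ -trmx_mul gQ trmx0 eqxx gL //=.
by rewrite -(opprK Lam) -skewLam mulNmx -trmx_mul gL // symS subrr.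
Qed.

Lemma dim_annihilator_geq :
  ('C((\rank (kermx Q)).+1, 2) <= \dim (annihilator (Q + Lam)))%N.
Proof. by rewrite -dim_annihilator_ker dimvS // capvSl. Qed.

Lemma mulmx_annihilator_skew X :
  X \in annihilator (Q + Lam) -> X *m Q \in twisted_sym (-1) Q.
Proof.
rewrite annihilator_cap // memv_cap => /andP []; rewrite mem_annihilator.
rewrite mem_twisted_sym submxMl andbT trmx_mul symQ scaleN1r.
by rewrite addrC addr_eq0.
Qed.

(** Rank-nullity for [X |-> X *m Q] on the annihilator. *)
Lemma dim_annihilator_leq :
  (\dim (annihilator (Q + Lam)) <=
    'C((\rank (kermx Q)).+1, 2) + 'C(\rank Q, 2))%N.
Proof.
rewrite -(limg_ker_dim (linfun (mulmxr Q)) (annihilator _)) dim_annihilator_ker.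
rewrite leq_add2l -(dim_skew two_neq0); apply/dimvS/subvP => _ /memv_imgP [X + ->].
by rewrite lfunE; apply: mulmx_annihilator_skew.
Qed.

Lemma rank_kermx_sum : (\rank (kermx Lam) + \rank (kermx Q) =
  \rank (kermx Lam + kermx Q)%MS)%N.
Proof. by rewrite -mxrank_sum_cap capmxC cap_kermx_sym_skew mxrank0 addn0. Qed.

(** * The case where [W] is the direct sum of [E] and [F] *)

Section KernelsSpan.
Hypothesis span : (\rank (kermx Lam) + \rank (kermx Q))%N = k.
Let G := row_base (kermx Q).

Lemma mul_kermx_eq0 m (A : 'M[K]_(k, m)) :
  kermx Lam *m A = 0 -> G *m A = 0 -> A = 0.
Proof.
move=> EA GA; have /sub_addsmxP [[u v] /= uv] : (1%:M <= kermx Lam + G)%MS.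
  rewrite sub1mx /row_full -[X in _ == X]span rank_kermx_sum.
  by apply/eqP/eqmx_rank/eqmxP/adds_eqmx => //; apply: eq_row_base.
by rewrite -[A]mul1mx uv mulmxDl -(mulmxA u) -(mulmxA v) EA GA !mulmx0 addr0.
Qed.

Lemma base_kermx_mul : G *m Q = 0.
Proof. by apply/sub_kermxP; rewrite eq_row_base. Qed.

Lemma kermx_skew_tr : Lam *m (kermx Lam)^T = 0.
Proof.
by apply: trmx_inj; rewrite trmx_mul trmxK skewLam mulmxN mulmx_ker oppr0 trmx0.
Qed.

Lemma mem_annihilator_restr X : \rank Q = 1%N ->
  X \in annihilator (Q + Lam) <->
  exists2 Y, Y \in sp (restr_form Lam (kermx Q)) &
             extends_by_zero (kermx Lam) Y X.
Proof.
move=> rankQ; split => [Xh | [Y Ysp [EX GX]]].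
  (* [X *m Q] is skew with row space in a line, and ['C(1, 2) = 0]. *)
  have XQ : X *m Q = 0.
    have := mulmx_annihilator_skew Xh; have := dim_skew two_neq0 Q.
    by rewrite rankQ => /eqP; rewrite dimv_eq0 => /eqP ->; rewrite memv0 => /eqP.
  have XL : X *m Lam + Lam *m X^T = 0.
    move: Xh; rewrite annihilator_cap // memv_cap => /andP [_].
    by rewrite mem_annihilator => /eqP.
  have /submxP [Y GX] : (G *m X <= G)%MS.
    rewrite eq_row_base; apply: mulmx_sub; exact/sub_kermxP.
  exists Y.
    rewrite mem_annihilator -/(lie_act _ Y) (lie_act_congr _ GX).
    by rewrite /lie_act XL mulmx0 mul0mx.
  (* [E *m X] is killed by [Q] since [X *m Q = 0], and by [Lam] since
     [E *m X *m Lam = - E *m Lam *m X^T = 0]. *)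
  split=> //; apply: mul_sym_skew_eq0; first by rewrite -mulmxA XQ mulmx0.
  move/eqP: XL; rewrite addr_eq0 -mulmxA => /eqP ->.
  by rewrite mulmxN mulmxA mulmx_ker mul0mx oppr0.
have XQ : X *m Q = 0.
  apply: mul_kermx_eq0; first by rewrite mulmxA EX mul0mx.
  by rewrite mulmxA GX -mulmxA base_kermx_mul mulmx0.
rewrite annihilator_cap // memv_cap !mem_annihilator.
rewrite -{2}symQ -trmx_mul XQ trmx0 addr0 eqxx /=.
have EXt : X^T *m (kermx Lam)^T = 0 by rewrite -trmx_mul EX trmx0.
(* The form is tested on [E] against [W], then on [F] against [E] and on [F] against [F]; only the
   last uses that [Y] annihilates the restricted form. *)
apply/eqP/mul_kermx_eq0.
  by rewrite mulmxDr !mulmxA EX mulmx_ker !mul0mx addr0.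
apply: trmx_inj; rewrite trmx0; apply: mul_kermx_eq0.
  apply: trmx_inj; rewrite trmx0 trmx_mul !trmxK mulmxDr mulmxDl -!mulmxA.
  by rewrite kermx_skew_tr EXt !mulmx0 addr0.
apply: trmx_inj; rewrite trmx0 trmx_mul !trmxK.
move: Ysp; rewrite mem_annihilator -/(lie_act _ Y) (lie_act_congr _ GX).
by move/eqP.
Qed.

End KernelsSpan.
End NondegenerateSum.
End AnnihilatorDimension.

(* The triple (0, 2, 0), which forces k = 2, has to be excluded as well: if Q
   and Lam are nondegenerate on a plane then so(Q) lies in sl_2 = sp(Lam), so
   the annihilator of B is so(Q), of dimension 1 = 'C(2, 2). *)
Theorem lemma1p2 (R : realType) (k : nat) (B Q Lam L : 'M[R[i]]_k)
    (B_full_rank : \rank B = k)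
    (B_decomp : B = Q + Lam)
    (Q_sym : Q^T = Q)
    (Lam_skew : Lam^T = - Lam)
    (L_compl : is_complement L (kermx Lam + kermx Q)%MS) :
  let E := kermx Lam in
  let F := kermx Q in
  let e := \rank E in
  let l := \rank L in
  let f := \rank F in
  let h := annihilator B in
  [/\ (e, l, f) <> (0, 0, k)%N ->
      (e, l, f) <> (k, 0, 0)%N ->
      (e, l, f) <> (0, 1, k.-1)%N ->
      (e, l, f) <> (1, 0, k.-1)%N ->
      (e, l, f) <> (0, 2, 0)%N ->
      (\dim h < 'C(k, 2))%N,
      (e, l, f) = (0, 0, k)%N ->
      [/\ ~~ odd k, B = Lam, h = sp Lam & \dim h = 'C(k.+1, 2)],
      (e, l, f) = (k, 0, 0)%N ->
      [/\ B = Q, h = so Q & \dim h = 'C(k, 2)],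
      (e, l, f) = (0, 1, k.-1)%N ->
      ~~ odd k /\ \dim h = 'C(k, 2) &
      (e, l, f) = (1, 0, k.-1)%N ->
      [/\ odd k,
          forall X : 'M[R[i]]_k,
            X \in h <->
            exists2 Y, Y \in sp (restr_form Lam F) & extends_by_zero E Y X
        & \dim h = 'C(k, 2)]].
Proof.
move=> E F e l f h.
have two_neq0 : 2%:R != 0 :> R[i] by rewrite pnatr_eq0.
have fullB : \rank (Q + Lam)%R = k by rewrite -B_decomp.
have rank_sum : (e + l + f)%N = k.
  have [/eqmx_rank cap /eqmx_rank sum] := L_compl.
  have := mxrank_sum_cap L (E + F)%MS; rewrite cap sum mxrank0 mxrank1 addn0.
  by rewrite -(rank_kermx_sum fullB) => ->; rewrite addnCA addnA.
have eE : e = (k - \rank Lam)%N by rewrite /e mxrank_ker.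
have fE : f = (k - \rank Q)%N by rewrite /f mxrank_ker.
have := rank_leq_row Lam; have := rank_leq_row Q => rQ rLam.
have evenLam := skew_rank_even two_neq0 Lam_skew.
have lower := dim_annihilator_geq two_neq0 Q_sym Lam_skew fullB.
have upper := dim_annihilator_leq two_neq0 Q_sym Lam_skew fullB.
rewrite -B_decomp -/h -/F -/f in lower upper.
have rQE : \rank Q = (k - f)%N by lia.
have unitQ : f = 0%N -> Q \in unitmx.
  by move=> f0; rewrite -row_free_unit /row_free; apply/eqP; lia.
rewrite rQE in upper.
split.
- move=> n1 n2 n3 n4 n5.
  have [f0 | f_gt0] := posnP f.
    have Lam_neq0 : Lam <> 0.
      move=> Lam0; apply: n2; have rL : \rank Lam = 0%N by rewrite Lam0 mxrank0.
      by congr (_, _, _); lia.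
    (* For [k <= 2] every triple with [f = 0] is excluded: the rank [k - e] of [Lam] is even, which
       rules out [e = 1] when [k = 2]. *)
    have k_gt2 : (2 < k)%N.
      rewrite ltnNge; apply/negP => k_le2.
      have [k0|[k1|k2]] : k = 0%N \/ k = 1%N \/ k = 2 by lia.
      + by apply: n1; rewrite k0; congr (_, _, _); lia.
      + by apply: n2; congr (_, _, _); lia.
      + have [e0|[e1|e2]] : e = 0%N \/ e = 1%N \/ e = 2 by lia.
        * by apply: n5; congr (_, _, _); lia.
        * by lia.
        * by apply: n2; congr (_, _, _); lia.
    (* If the bound failed, [h] would be all of [annihilator Q], which would then lie in
       [annihilator Lam]. *)
    rewrite ltnNge -(dim_annihilator_sym two_neq0 Q_sym (unitQ f0)); apply/negP => le_dim.
    apply: Lam_neq0.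
    apply: (annihilator_sym_sub two_neq0 k_gt2 Q_sym (unitQ f0) Lam_skew).
    have hE : h = (annihilator Q :&: annihilator Lam)%VS.
      by rewrite /h B_decomp; apply: annihilator_cap.
    have /eqP hQ : h == annihilator Q by rewrite eqEdim le_dim andbT hE capvSl.
    by rewrite -hQ hE capvSr.
  have f_le : (f + 2 <= k)%N.
    rewrite leqNgt; apply/negP => f_gt.
    have [ef|[ef|[e1 l0]]] : (e + l = 0)%N \/ (e = 0 /\ l = 1)%N \/ (e = 1 /\ l = 0)%N.
      lia.
    + by apply: n1; congr (_, _, _); lia.
    + by apply: n3; congr (_, _, _); lia.
    + by apply: n4; congr (_, _, _); lia.
  apply: leq_ltn_trans upper _.
  have [g kE] : exists g, k = (f + g)%N by exists (k - f)%N; lia.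
  (* The gap between ['C(k, 2)] and the upper bound is [f * g - f], positive since [f > 0] and
     [g >= 2]. *)
  rewrite kE bin2D addKn binS bin1; nia.
- case=> e0 l0 fk; have Q0 : Q = 0 by apply/eqP; rewrite -mxrank_eq0; lia.
  have BL : B = Lam by rewrite B_decomp Q0 add0r.
  split; [by lia | exact: BL | by rewrite /h BL |].
  (* For [f = k] the term ['C(k - f, 2)] vanishes and the bounds agree. *)
  by rewrite fk subnn addn0 in lower upper; apply/eqP; rewrite eqn_leq upper.
- case=> ek l0 f0; have L0 : Lam = 0 by apply/eqP; rewrite -mxrank_eq0; lia.
  have BQ : B = Q by rewrite B_decomp L0 addr0.
  split; [exact: BQ | by rewrite /h BQ |].
  by rewrite /h BQ (dim_annihilator_sym two_neq0 Q_sym (unitQ f0)).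
(* The ranks sum to [k], so [k = 0], where [k.-1] truncates, cannot occur. Evenness of [k] is that
   of [\rank Lam = k - e], and the bounds agree because ['C(1, 2) = 0]. *)
- case=> e0 l1 fk; have kE : k = f.+1 by lia.
  split; first by lia.
  rewrite (_ : k - f = 1)%N ?addn0 in upper; last by lia.
  by rewrite -kE in lower upper; apply/eqP; rewrite eqn_leq upper.
- case=> e1 l0 fk; have kE : k = f.+1 by lia.
  (* Here [\rank Lam = k - 1] is even. *)
  split; first by lia.
  - move=> X; rewrite /h B_decomp; apply: (mem_annihilator_restr two_neq0 Q_sym Lam_skew fullB).
      by move: rank_sum; rewrite l0 addn0.
    by lia.
  rewrite (_ : k - f = 1)%N ?addn0 in upper; last by lia.
  by rewrite -kE in lower upper; apply/eqP; rewrite eqn_leq upper.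
Qed.
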